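(* Let $\rho\in(0,1)$ and, for each $n$, let $(X_1,\ldots,X_n)$ be jointly normal with $X_i\sim\mathcal N(\mu_i,1)$, $\mu_i\ge0$, and $\operatorname{Corr}(X_i,X_j)=\rho$ for all $i\neq j$. Suppose $\sup_i\mu_i$ is finite. Then, for any combination of true and false null hypotheses (i.e. whatever the set of indices $i$ with $\mu_i=0$), $$\lim_{n\to\infty}FWER_{Hochberg}(n,\alpha,\rho)=0$$ for any $\alpha\in(0,1/2)$.
   Context: Testing problem: test $H_{0i}:\mu_i=0$ against $H_{1i}:\mu_i>0$, $1\le i\le n$ (so always $\mu_i\ge0$). The p-values are $P_i=1-\Phi(X_i)$, with $\Phi$ the standard normal distribution function, and $P_{(1)}\le\cdots\le P_{(n)}$ are the ordered p-values, with corresponding null hypotheses $H_{(1)},\ldots,H_{(n)}$. For a multiple testing procedure $T$, $V_n(T)$ is the number of type I errors (rejected hypotheses $H_{0i}$ with $\mu_i=0$), and $FWER_T(n,\alpha,\rho)=\mathbb P(V_n(T)\ge1)$, the probability being computed under the equicorrelated model with correlation $\rho$. Hochberg's procedure at level $\alpha$ is the step-up procedure with cutoffs $u_i=\alpha/(n-i+1)$: it rejects $H_{(1)},\ldots,H_{(m)}$ where $m=\max\{i:P_{(i)}\le u_i\}$, and rejects nothing if no such $i$ exists. *)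

(* Defs.v *)
From HB Require Import structures.
From mathcomp Require Import all_boot all_order all_algebra.
From mathcomp Require Import all_classical all_reals all_analysis.

Set Implicit Arguments.
Unset Strict Implicit.
Unset Printing Implicit Defensive.

Import Order.TTheory GRing.Theory Num.Theory.
Import numFieldNormedType.Exports.

Local Open Scope classical_set_scope.
Local Open Scope ring_scope.

Section NormalVectors.
Context {R : realType} {d : measure_display} {T : measurableType d}.
Variable P : probability T R.

(* The laws are compared on measurable sets only: the values of a measure on
   other sets are unspecified.
   The case [s = 0] is separate because [normal_prob m 0] is the uniform law on
   [0, 1] and not the point mass at [m]. *)
Definition has_normal_law (X : T -> R) (m s : R) : Prop :=
  forall A : set R, measurable A ->
    P (X @^-1` A) = if s == 0 then \d_m A else normal_prob m s A.

Definition jointly_normal (n : nat) (X : 'I_n -> {RV P >-> R}) : Prop :=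
  forall a : 'I_n -> R, exists m s : R,
    0 <= s /\ has_normal_law (fun w => \sum_(i < n) a i * X i w) m s.

Definition correlation (X Y : T -> R) : R :=
  fine (covariance P X Y) /
  (Num.sqrt (fine (variance P X)) * Num.sqrt (fine (variance P Y))).

End NormalVectors.

Section MultipleTesting.
Context {R : realType}.

Definition std_normal_cdf (x : R) : R := fine (normal_prob 0 1 `]-oo, x]).

Definition pvalue (x : R) : R := 1 - std_normal_cdf x.

(* A procedure maps the vector of p-values to the set of rejected hypotheses. *)
Definition testing_procedure (n : nat) := ('I_n -> R) -> {set 'I_n}.

(* The indices of the hypotheses H_(1), ..., H_(n); ties between p-values are
   broken by the index. *)
Definition ordered_hypotheses (n : nat) (p : 'I_n -> R) : seq 'I_n :=
  sort (fun i j => p i <= p j) (enum 'I_n).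

Definition ordered_pvalues (n : nat) (p : 'I_n -> R) : seq R :=
  [seq p i | i <- ordered_hypotheses p].

(* With the 0-based index [i], the entry [i] of [ordered_pvalues p] is P_(i+1);
   the cutoffs [u] are indexed from 1. The maximum of the empty family is 0, and
   then nothing is rejected. *)
Definition step_up (u : nat -> R) (n : nat) : testing_procedure n :=
  fun p =>
    let m := (\max_(i < n | ((ordered_pvalues p)`_i <= u i.+1)%R) i.+1)%N in
    [set i in take m (ordered_hypotheses p)].

Definition hochberg (alpha : R) (n : nat) : testing_procedure n :=
  step_up (fun i => alpha / (n - i + 1)%:R) (n := n).

Definition type1_errors (n : nat) (mu : 'I_n -> R) (T : testing_procedure n)
    (x : 'I_n -> R) : nat :=
  #|[set i | (i \in T (fun j => pvalue (x j))) && (mu i == 0)]%SET|.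

Definition FWER (n : nat) (mu : 'I_n -> R) (T : testing_procedure n)
    (d : measure_display) (W : measurableType d) (P : probability W R)
    (X : 'I_n -> {RV P >-> R}) : \bar R :=
  P [set w | (1 <= type1_errors mu T (fun i => X i w))%N].

End MultipleTesting.

(* Main.v *)
Require Import Defs.
From HB Require Import structures.
From mathcomp Require Import all_boot all_order all_algebra.
From mathcomp Require Import all_classical all_reals all_analysis.
From mathcomp Require Import measurable_realfun ring lra.

Set Implicit Arguments.
Unset Strict Implicit.
Unset Printing Implicit Defensive.

Import Order.TTheory GRing.Theory Num.Theory.
Import numFieldNormedType.Exports.

Local Open Scope classical_set_scope.
Local Open Scope ring_scope.

(** In fact the probability of rejecting anything at all tends to 0.  Write
    [X_j = mu_j + U + Y_j] where [U] is the mean of the [X_i - mu_i]; then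
    [Var U <= 1], [Var Y_j = (1 - rho) (1 - 1/n)], and the [Y_j] are slightly
    negatively correlated.  Hochberg's procedure rejects something only if, for
    some [kappa] in [1, n], fewer than [kappa] p-values exceed [alpha / kappa].
    Off an event of small probability [U < K], and the average of the
    [exp (- t Y_j)] is close to its (large) mean, so that a fixed proportion
    [delta] of the [Y_j] is very negative and more than [delta n] p-values
    exceed [alpha]; hence [kappa > delta n].  Then some p-value is at most
    [alpha / (delta n)], which forces some [Y_j] to be about [sqrt (2 ln n)];
    as [Var Y_j <= 1 - rho < 1], a union bound excludes this.  Only the moment
    generating functions of linear combinations of the [X_i] are used. *)

(** * The normal law *)

Lemma markov_ge0 d (T : measurableType d) (R : realType)
    (mu : {measure set T -> \bar R}) (f : T -> R) (c : R) : 0 < c ->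
    measurable_fun setT f -> (forall x, 0 <= f x) ->
  (mu [set x | (c <= f x)%R] <= (c^-1)%:E * \int[mu]_x (f x)%:E)%E.
Proof.
move=> c0 mf f0; rewrite lee_pdivlMl// -(setTI [set x | _]).
have absf x : `|f x| = f x by rewrite ger0_norm.
have := @le_integral_comp_abse _ _ _ mu _ measurableT (EFin \o f) c id.
under eq_integral do rewrite /= absf.
have -> : [set x | (c%:E <= `|(EFin \o f) x|)%E] = [set x | c <= f x].
  by apply/funext => x /=; rewrite lee_fin absf.
by apply => //; exact/measurable_EFinP.
Qed.

Section NormalLaw.
Context {R : realType}.
Implicit Types m s t : R.

(** The Radon-Nikodym derivative of the normal law agrees almost everywhere with [normal_pdf],
    because both have the same integral over every measurable set. *)
Lemma ge0_integral_normal_prob m s (f : R -> \bar R) :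
    measurable_fun setT f -> (forall x, 0 <= f x)%E ->
  (\int[normal_prob m s]_x f x =
   \int[lebesgue_measure]_x (f x * (normal_pdf m s x)%:E))%E.
Proof.
move=> mf f0.
have dom := normal_prob_dominates m s.
rewrite -(Radon_Nikodym_SigmaFinite.change_of_variables dom)//.
have mpdf : measurable_fun setT (EFin \o normal_pdf m s).
  by apply/measurable_EFinP; exact: measurable_normal_pdf.
apply: ae_eq_integral => //.
- apply: emeasurable_funM => //.
  exact: measurable_int (Radon_Nikodym_SigmaFinite.f_integrable dom).
- exact: emeasurable_funM.
- apply: ae_eqe_mul2l; apply: integral_ae_eq => //.
    exact: Radon_Nikodym_SigmaFinite.f_integrable.
  by move=> E _ mE; rewrite -Radon_Nikodym_SigmaFinite.f_integral.
Qed.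

(** Completing the square: exponential tilting by [t] moves the mean by [t * s ^+ 2] and leaves a
    constant factor, which is the moment generating function. *)
Lemma normal_pdf_expR m s t x : s != 0 ->
  expR (t * x) * normal_pdf m s x =
  expR (t * m + t ^+ 2 * s ^+ 2 / 2) * normal_pdf (m + t * s ^+ 2) s x.
Proof.
move=> s0; rewrite !normal_pdfE// /normal_fun.
rewrite mulrCA [RHS]mulrCA -!expRD; congr (_ * expR _).
by field.
Qed.

Lemma normal_mgf m s t : s != 0 ->
  (\int[normal_prob m s]_x (expR (t * x))%:E =
   (expR (t * m + t ^+ 2 * s ^+ 2 / 2))%:E)%E.
Proof.
move=> s0; rewrite ge0_integral_normal_prob//; last first.
  by apply/measurable_EFinP; apply: measurableT_comp => //; exact: measurable_funM.
under eq_integral do rewrite -EFinM normal_pdf_expR// EFinM.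
rewrite ge0_integralZl//; last 2 first.
- by apply/measurable_EFinP; exact: measurable_normal_pdf.
- by move=> x _; rewrite lee_fin normal_pdf_ge0.
by rewrite integral_normal_pdf mule1.
Qed.

Lemma normal_central_moment2 m s : 0 < s ->
  (\int[normal_prob m s]_x ((x - m) ^+ 2)%:E =
   (s ^+ 2)%:E * \int[normal_prob 0 1]_x (x ^+ 2)%:E)%E.
Proof.
move=> s0; rewrite !ge0_integral_normal_prob//; last 4 first.
- by apply/measurable_EFinP; apply: measurable_funX.
- by move=> x; rewrite lee_fin sqr_ge0.
- by apply/measurable_EFinP; apply: measurable_funX; apply: measurable_funB.
- by move=> x; rewrite lee_fin sqr_ge0.
(* [F x] is [s * x + m], factored so that its limits at both infinities come from a translation
   followed by a positive scaling. *)
pose F (x : R) : R := (x + m / s) * s.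
have dF (x : R) : is_derive x (1 : R) F s.
  rewrite /F; apply: is_derive_eq.
  by rewrite !scaler0 addr0 /GRing.scale/= mulr1 add0r.
have F'E : F^`()%classic = cst s.
  by apply/funext => x; rewrite derive1E; apply: derive_val.
under [LHS]eq_integral do rewrite -EFinM.
rewrite (@increasing_ge0_integration_by_substitutionT _ F
  (fun x => (x - m) ^+ 2 * normal_pdf m s x)); first last.
- by move=> x; rewrite mulr_ge0 ?sqr_ge0 ?normal_pdf_ge0.
- move=> x; apply: cvgM.
    apply: (@cvg_comp _ _ _ (fun x => x - m) (fun x => x ^+ 2)).
      by apply: cvgB; [exact: cvg_id|exact: cvg_cst].
    exact: sqr_continuous.
  by apply: continuous_normal_pdf; rewrite gt_eqF.
- by apply: gt0_cvgMly => //; exact: cvg_addrr.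
- by apply: gt0_cvgMlNy => //; exact: cvg_addrr_Ny.
- by move=> x; apply: ex_derive.
- by rewrite F'E; exact: is_cvg_cst.
- by rewrite F'E; exact: is_cvg_cst.
- by rewrite F'E => x; exact: cvg_cst.
- by move=> x y xy; rewrite /F ltr_pM2r// ltrD2r.
rewrite -ge0_integralZl//; last 3 first.
- apply: emeasurable_funM; first by apply/measurable_EFinP; apply: measurable_funX.
  by apply/measurable_EFinP; exact: measurable_normal_pdf.
- by move=> x _; rewrite -EFinM lee_fin mulr_ge0 ?sqr_ge0 ?normal_pdf_ge0.
- by rewrite lee_fin sqr_ge0.
apply: eq_integral => x _; rewrite -!EFinM; congr EFin.
rewrite !fctE F'E /F !normal_pdfE ?oner_eq0 ?gt_eqF// /normal_fun.
have -> : - ((x + m / s) * s - m) ^+ 2 / (s ^+ 2 *+ 2) = - (x - 0) ^+ 2 / (1 ^+ 2 *+ 2).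
  by field; rewrite gt_eqF.
have -> : @normal_peak R s = s^-1 * normal_peak 1.
  rewrite /normal_peak -mulrnAr sqrtrM ?sqr_ge0// sqrtr_sqr gtr0_norm//.
  by rewrite invfM expr1n mul1r.
by rewrite /cst; field; rewrite gt_eqF.
Qed.

(** The density decreases on the positive half-line, so the mass of []x, x + 1]], an interval of
    length 1, is at least the density at its right end. *)
Lemma std_normal_tail (x : R) : 0 <= x -> normal_pdf 0 1 (x + 1) <= pvalue x.
Proof.
move=> x0; rewrite /pvalue /std_normal_cdf.
set N := (normal_prob 0 1 : probability _ R).
rewrite -lee_fin EFinB fineK ?(fin_num_measure N)//.
have -> : (1%:E - normal_prob 0 1 `]-oo, x] = N `]x, +oo[%classic)%E.
  by rewrite -setCitvl probability_setC.
apply: (@le_trans _ _ (N `]x, (x + 1)%R]%classic)).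
  have xx1 : (x%:E < (x + 1)%:E)%E by rewrite lte_fin ltrDl.
  have -> : (normal_pdf 0 1 (x + 1))%:E =
      (\int[lebesgue_measure]_(y in `]x, (x + 1)%R]) (normal_pdf 0 1 (x + 1)%R)%:E)%E.
    rewrite integral_cst//= lebesgue_measure_itv/= xx1.
    by rewrite -EFinB addrAC subrr add0r mule1.
  apply: ge0_le_integral => //.
  - by move=> y _; rewrite lee_fin normal_pdf_ge0.
  - by apply/measurable_EFinP/measurable_funTS; exact: measurable_normal_pdf.
  - move=> y /=; rewrite in_itv/= => /andP[xy yx].
    rewrite lee_fin !normal_pdfE ?oner_eq0// ler_wpM2l ?normal_peak_ge0//.
    rewrite ler_expR !subr0 !mulNr lerN2 ler_wpM2r ?invr_ge0 ?mulrn_wge0//.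
    by rewrite ler_sqr ?nnegrE//; lra.
apply: le_measure; rewrite ?inE//.
by apply: subset_itvl; rewrite bnd_simp.
Qed.

Lemma std_normal_cdf_nondecreasing : nondecreasing_fun (@std_normal_cdf R).
Proof.
move=> x y xy; set N := (normal_prob 0 1 : probability _ R).
rewrite fine_le ?(fin_num_measure N)//.
by apply: (le_measure N); rewrite ?inE//; apply: subset_itvl; rewrite bnd_simp.
Qed.

Lemma pvalue_nonincreasing : nonincreasing_fun (@pvalue R).
Proof. by move=> x y xy; rewrite lerB// std_normal_cdf_nondecreasing. Qed.

(** A p-value at most [alpha < 1 / 2] will thus force an observation above [-2]. Markov's inequality
    for [exp (- x)] bounds the lower tail at [-2] by [exp (- 3 / 2)], and [exp (3 / 2) >= 5 / 2]. *)
Lemma pvalueN2_gt : 1 / 2 < pvalue (- 2 : R).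
Proof.
set N := (normal_prob 0 1 : probability _ R).
have : (N `]-oo, (- 2)%R]%classic <= (expR (- (3 / 2)))%:E)%E.
  have -> : `]-oo, - 2]%classic = [set x : R | expR 2 <= expR (- 1 * x)].
    apply/seteqP; split=> x /=; rewrite in_itv/= ler_expR; lra.
  apply: (le_trans (markov_ge0 _ _ _ _)).
  - exact: expR_gt0.
  - by apply: measurableT_comp => //; exact: measurable_funM.
  - by move=> x; exact: expR_ge0.
  rewrite normal_mgf ?oner_neq0// -EFinM lee_fin -expRN -expRD ler_expR; lra.
have -> : N `]-oo, (- 2)%R]%classic = (std_normal_cdf (- 2))%:E.
  by rewrite /std_normal_cdf fineK// (fin_num_measure N).
rewrite lee_fin expRN => /le_lt_trans-/(_ (1 / 2)).
rewrite /pvalue => /(_ _)/wrap[|]; last by lra.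
have := expR_ge1Dx (3 / 2 : R) => h.
rewrite div1r ltf_pV2 ?posrE ?expR_gt0//; lra.
Qed.
End NormalLaw.

(** * Moments of normal random variables *)

Lemma measurable_ler_set d (T : measurableType d) (R : realType) (f g : T -> R) :
    measurable_fun setT f -> measurable_fun setT g ->
  measurable [set x | f x <= g x].
Proof.
move=> mf mg; rewrite -[X in measurable X]setTI.
have := measurable_fun_ler mf mg measurableT (_ : measurable [set true]).
by apply.
Qed.

Lemma sqr_le_expR (R : realType) (x : R) : x ^+ 2 <= 2 * (expR x + expR (- x)).
Proof.
rewrite -real_normK ?num_real//.
have : 1 + `|x| ^+ 2 / 2 <= expR `|x| by exact: (expR_ge1Dxn 1).
have : expR `|x| <= expR x + expR (- x).
  by case: (ger0P x) => _; rewrite (lerDl, lerDr) expR_ge0.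
lra.
Qed.

Lemma integral_sqr_lty d (T : measurableType d) (R : realType)
    (mu : {measure set T -> \bar R}) (f : T -> R) : measurable_fun setT f ->
    (forall t : R, \int[mu]_x (expR (t * f x))%:E < +oo)%E ->
  (\int[mu]_x (f x ^+ 2)%:E < +oo)%E.
Proof.
move=> mf fexp.
have mexp t : measurable_fun setT (fun x => (expR (t * f x))%:E).
  by apply/measurable_EFinP; apply: measurableT_comp => //; exact: measurable_funM.
apply: (@le_lt_trans _ _
  (\int[mu]_x (2%:E * ((expR (1 * f x))%:E + (expR (-1 * f x))%:E)))%E).
  apply: ge0_le_integral => //.
  - by move=> x _; rewrite lee_fin sqr_ge0.
  - by apply/measurable_EFinP; exact: measurable_funX.
  - by apply: measurable_funeM; exact: emeasurable_funD.
  - by move=> x _; rewrite lee_fin mul1r mulN1r sqr_le_expR.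
rewrite ge0_integralZl//; last 2 first.
- exact: emeasurable_funD.
- by move=> x _; rewrite -EFinD lee_fin addr_ge0 ?expR_ge0.
rewrite ge0_integralD//.
by apply: lte_mul_pinfty => //; exact: lte_add_pinfty.
Qed.

Lemma std_normal_moment2_lty (R : realType) :
  (\int[normal_prob (0 : R) 1]_x (x ^+ 2)%:E < +oo)%E.
Proof.
apply: integral_sqr_lty => // t.
by rewrite normal_mgf ?oner_neq0// ltry.
Qed.

Lemma std_normal_moment2_gt0 (R : realType) :
  (0 < \int[normal_prob (0 : R) 1]_x (x ^+ 2)%:E)%E.
Proof.
set N := (normal_prob 0 1 : probability _ R).
have N1 : (0 < N `]1%R, +oo[%classic)%E.
  apply: (@lt_le_trans _ _ (normal_pdf 0 1 (1 + 1))%:E).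
    by rewrite lte_fin normal_pdfE ?oner_neq0// mulr_gt0 ?normal_peak_gt0 ?oner_neq0 ?expR_gt0.
  have := @std_normal_tail R 1 ler01; rewrite /pvalue -lee_fin => /le_trans; apply.
  rewrite EFinB /std_normal_cdf fineK ?(fin_num_measure N)//.
  by rewrite -setCitvl probability_setC.
apply: (lt_le_trans N1).
have := @markov_ge0 _ _ _ N (fun x => x ^+ 2) 1 ltr01.
rewrite invr1 mul1e => /(_ _ _)/wrap[].
- exact: measurable_funX.
- by move=> x; exact: sqr_ge0.
apply: le_trans; apply: le_measure; rewrite ?inE//.
  by apply: measurable_ler_set => //; exact: measurable_funX.
move=> x /=; rewrite in_itv/= andbT => x1.
by rewrite -[leLHS](expr1n _ 2) ler_sqr ?nnegrE//; lra.
Qed.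

Section NormalRV.
Context {R : realType} {d : measure_display} {T : measurableType d}.
Variable P : probability T R.
Variables (X : T -> R) (m s : R).
Hypothesis mX : measurable_fun setT X.
Hypothesis lawX : has_normal_law P X m s.

(** Integration is transferred to the image law of [X], which is a point mass when [s = 0]. *)
Lemma ge0_integral_normal_law (f : R -> \bar R) :
    measurable_fun setT f -> (forall x, 0 <= f x)%E ->
  (\int[P]_w f (X w) =
   if s == 0%R then f m else \int[normal_prob m s]_x f x)%E.
Proof.
move=> mf f0.
pose X' : {RV P >-> measurableTypeR R} :=
  @mfun_Sub _ _ T (measurableTypeR R) X (mem_set mX).
have -> : (\int[P]_w f (X w) = \int[distribution P X']_x f x)%E.
  by rewrite ge0_integral_distribution.
have [s0|s0] := eqVneq s 0.
  rewrite (@eq_measure_integral _ (measurableTypeR R) R setT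
    (@dirac _ (measurableTypeR R) m R) (distribution P X')) => [|A mA _].
    by rewrite integral_dirac// diracT mul1e.
  by have /= := lawX mA; rewrite s0 eqxx.
apply: (@eq_measure_integral _ (measurableTypeR R) R setT
  (normal_prob m s) (distribution P X')) => A mA _.
by have /= := lawX mA; rewrite (negbTE s0).
Qed.

Lemma normal_law_mgf t :
  (\int[P]_w (expR (t * X w))%:E = (expR (t * m + t ^+ 2 * s ^+ 2 / 2))%:E)%E.
Proof.
rewrite (ge0_integral_normal_law (f := fun x => (expR (t * x))%:E)); last 2 first.
- by apply/measurable_EFinP; apply: measurableT_comp => //; exact: measurable_funM.
- by move=> x; rewrite lee_fin expR_ge0.
have [s0|s0] := eqVneq s 0; last by rewrite normal_mgf.
by rewrite s0 expr0n/= mulr0 mul0r addr0.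
Qed.

Lemma normal_law_Lfun2 : X \in Lfun P 2%:E.
Proof.
rewrite inE/=; apply/andP; split; rewrite inE//= /finite_norm unlock poweR_lty//.
under eq_integral => x _ do
  rewrite /= powR_mulrn ?normr_ge0// real_normK ?num_real//.
by apply: integral_sqr_lty => // t; rewrite normal_law_mgf ltry.
Qed.

(* Integrating [1 + t (X - m) <= exp (t (X - m))] shows that
   [t |-> 1 + t (E X - m)] stays below a function with zero slope at [0]. *)
Lemma normal_law_expectation : ('E_P[X] = m%:E)%E.
Proof.
have X2 := normal_law_Lfun2.
have X1 : X \in Lfun P 1 by apply: Lfun_subset12 => //; exact: fin_num_measure.
have fE : 'E_P[X]%E \is a fin_num by exact: expectation_fin_num.
rewrite -(fineK fE); congr EFin; set e := fine _.
have key t : 1 + t * (e - m) <= expR (t ^+ 2 * s ^+ 2 / 2).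
  have mexp : measurable_fun setT (fun w => expR (- (t * m)) * expR (t * X w)).
    apply: measurable_funM => //; apply: measurableT_comp => //.
    exact: measurable_funM.
  have Eexp : (\int[P]_w (expR (- (t * m)) * expR (t * X w))%:E =
      (expR (t ^+ 2 * s ^+ 2 / 2))%:E)%E.
    under eq_integral do rewrite EFinM.
    rewrite ge0_integralZl//; last first.
      by apply/measurable_EFinP; apply: measurableT_comp => //; exact: measurable_funM.
    by rewrite normal_law_mgf -EFinM -expRD addKr.
  have Eaff : ('E_P[(cst (1 - t * m) \+ t \o* X)%R] = (1 + t * (e - m))%:E)%E.
    rewrite expectationD ?Lfun_cst ?Lfun_scale// expectation_cst expectationZl//.
    by rewrite -(fineK fE) -/e -EFinM -EFinD; congr EFin; ring.
  move: Eaff; rewrite unlock => Eaff.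
  rewrite -lee_fin -Eexp -Eaff; apply: le_integral => //.
  - apply/Lfun1_integrable; apply: rpredD; first exact: Lfun_cst.
    exact: Lfun_scale.
  - apply/integrableP; split; first exact/measurable_EFinP.
    under eq_integral => w _ do
      rewrite gee0_abs ?lee_fin ?mulr_ge0 ?expR_ge0//.
    by rewrite Eexp ltry.
  - move=> w _; rewrite lee_fin -expRD /=.
    by apply: le_trans (expR_ge1Dx _); lra.
have [//|em] := eqVneq e m; exfalso.
pose D := e - m; pose c := s ^+ 2 / 2.
have D0 : 0 < D ^+ 2 by rewrite exprn_even_gt0//= subr_eq0.
have c0 : 0 <= c by rewrite mulr_ge0 ?sqr_ge0.
(* The inequality [key] is tested at [t = del * D]. This [del] makes both [del * c] and
   [del * D ^+ 2] at most [1 / 2]. *)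
pose del := (2 * (1 + c) * (1 + D ^+ 2))^-1.
have den0 : 0 < 2 * (1 + c) * (1 + D ^+ 2) by rewrite !mulr_gt0//; lra.
have del0 : 0 < del by rewrite invr_gt0.
have delE : del * (2 * (1 + c) * (1 + D ^+ 2)) = 1 by rewrite mulVf// gt_eqF.
have cD0 : 0 <= c * D ^+ 2 by rewrite mulr_ge0// ltW.
have delc : del * c <= 1 / 2 by nra.
have delD : del * D ^+ 2 <= 1 / 2 by nra.
pose u := del * (del * D ^+ 2) * c.
have keyu : 1 + del * D ^+ 2 <= expR u.
  by have := key (del * D); rewrite -/D; congr (_ <= expR _); rewrite /u /c; ring.
(* Multiplying by [1 - u <= exp (- u)] removes the exponential. With [a = del * D ^+ 2] and
   [b = del * c], [u = a * b], so the inequality would give [1 <= b * (1 + a) <= 3 / 4]. *)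
have : (1 + del * D ^+ 2) * (1 - u) <= 1.
  rewrite -[leRHS]expR0 -(subrr u) expRD; apply: ler_pM => //.
  - by rewrite addr_ge0// mulr_ge0// ltW.
  - by rewrite /u; nra.
  - exact: expR_ge1Dx.
rewrite /u; set a := del * D ^+ 2 in delD *.
have a0 : 0 < a by rewrite mulr_gt0.
have -> : del * a * c = a * (del * c) by ring.
have : 0 <= del * c by rewrite mulr_ge0// ltW.
move: delc; set b := del * c => b2 b0; nra.
Qed.

Lemma normal_law_variance : 0 <= s ->
  ('V_P[X] = (s ^+ 2)%:E * \int[normal_prob (0 : R) 1]_x (x ^+ 2)%:E)%E.
Proof.
move=> s_ge0; rewrite /variance unlock normal_law_expectation/= unlock.
under eq_integral => w _ do rewrite -[X in X%:E]/((X w - m) * (X w - m)) -expr2.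
rewrite (ge0_integral_normal_law (f := fun x => ((x - m) ^+ 2)%:E)); last 2 first.
- by apply/measurable_EFinP; apply: measurable_funX; exact: measurable_funB.
- by move=> x; rewrite lee_fin sqr_ge0.
have [->|s0] := eqVneq s 0; first by rewrite subrr expr0n/= mul0e.
by rewrite normal_central_moment2// lt_neqAle eq_sym s0.
Qed.

End NormalRV.

(** * Linear combinations of equicorrelated normal variables *)

Section LinearCombination.
Context {R : realType} {d : measure_display} {T : measurableType d}.
Variable P : probability T R.
Implicit Types (I : Type) (Z : T -> R).

Lemma lincomb_Lfun2 I (r : seq I) (a : I -> R) (X : I -> T -> R) :
    (forall i, X i \in Lfun P 2%:E) ->
  (fun w => \sum_(i <- r) a i * X i w) \in Lfun P 2%:E.
Proof.
move=> X2; elim: r => [|i r IH].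
  by under eq_fun do rewrite big_nil; exact: (Lfun_cst P 0 2).
under eq_fun do rewrite big_cons.
have aX : (fun w => a i * X i w) = a i \o* X i by apply/funext => w /=; rewrite mulrC.
have aX2 : (fun w => a i * X i w) \in Lfun P 2%:E.
  by rewrite aX; apply: Lfun_scale => //; rewrite ler1n.
by have := rpredD aX2 IH; apply; exact: lee1n.
Qed.

Lemma covariance_lincomb I (r : seq I) (a : I -> R) (X : I -> T -> R) Z :
    (forall i, X i \in Lfun P 2%:E) -> Z \in Lfun P 2%:E ->
  (covariance P (fun w => \sum_(i <- r) a i * X i w)%R Z =
   \sum_(i <- r) (a i)%:E * covariance P (X i) Z)%E.
Proof.
move=> X2 Z2; elim: r => [|i r IH].
  by under eq_fun do rewrite big_nil; rewrite big_nil; exact: (covariance_cst_l P 0 Z).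
rewrite big_cons -IH.
have aX : (fun w => a i * X i w) = a i \o* X i by apply/funext => w /=; rewrite mulrC.
have aX2 : (fun w => a i * X i w) \in Lfun P 2%:E.
  by rewrite aX; apply: Lfun_scale => //; rewrite ler1n.
have fT : P setT \is a fin_num by exact: fin_num_measure.
under [X in covariance P X]eq_fun do rewrite big_cons.
rewrite -[X in covariance P X]/
  ((fun w => a i * X i w) \+ (fun w => \sum_(j <- r) a j * X j w)).
rewrite covarianceDl ?lincomb_Lfun2//; congr (_ + _)%E.
rewrite aX covarianceZl//; [exact: Lfun_subset12|exact: Lfun_subset12|].
exact: Lfun2_mul_Lfun1.
Qed.

Lemma expectation_lincomb I (r : seq I) (a : I -> R) (X : I -> T -> R) :
    (forall i, X i \in Lfun P 2%:E) ->
  ('E_P[(fun w => \sum_(i <- r) a i * X i w)%R] =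
   \sum_(i <- r) (a i)%:E * 'E_P[X i])%E.
Proof.
move=> X2; elim: r => [|i r IH].
  by under eq_fun do rewrite big_nil; rewrite big_nil; exact: (expectation_cst P 0).
rewrite big_cons -IH.
have fT : P setT \is a fin_num by exact: fin_num_measure.
have X1 : X i \in Lfun P 1 by exact: Lfun_subset12.
have aX : (fun w => a i * X i w) = a i \o* X i by apply/funext => w /=; rewrite mulrC.
under [X in expectation _ X]eq_fun do rewrite big_cons.
rewrite -[X in expectation _ X]/
  ((fun w => a i * X i w) \+ (fun w => \sum_(j <- r) a j * X j w)).
rewrite expectationD ?aX ?expectationZl//; first exact: Lfun_scale.
by apply: Lfun_subset12 => //; exact: lincomb_Lfun2.
Qed.

End LinearCombination.

(** The variance of [\sum_i a i * X i] for unit variances and common correlation [rho]. *)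
Definition equicorr_form {R : realType} (rho : R) n (a : 'I_n -> R) : R :=
  (1 - rho) * (\sum_i a i ^+ 2) + rho * (\sum_i a i) ^+ 2.

Section Equicorrelated.
Context {R : realType} {d : measure_display} {T : measurableType d}.
Variables (P : probability T R) (n : nat) (X : 'I_n -> {RV P >-> R}).
Variables (mu : 'I_n -> R) (rho : R).
Hypothesis X_joint : jointly_normal X.
Hypothesis X_marg : forall i, has_normal_law P (X i) (mu i) 1.
Hypothesis X_corr : forall i j, i != j -> correlation P (X i) (X j) = rho.

(* [v] is 1, but only [0 < v < +oo] is needed: it cancels in [correlation]. *)
Let v : R := fine (\int[normal_prob (0 : R) 1]_x (x ^+ 2)%:E)%E.

Let vE : (\int[normal_prob (0 : R) 1]_x (x ^+ 2)%:E = v%:E)%E.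
Proof.
by rewrite fineK// ge0_fin_numE ?std_normal_moment2_lty// ltW ?std_normal_moment2_gt0.
Qed.

Let v_gt0 : 0 < v.
Proof. by rewrite -lte_fin -vE std_normal_moment2_gt0. Qed.

Let mX i : measurable_fun setT (X i). Proof. exact: measurable_funPT. Qed.

Let X2 i : (X i : T -> R) \in Lfun P 2%:E.
Proof. exact: normal_law_Lfun2. Qed.

Let covX i j : covariance P (X i) (X j) = (v * (if i == j then 1 else rho))%:E.
Proof.
have varX k : 'V_P[X k]%E = v%:E.
  by rewrite (normal_law_variance (mX k) (X_marg k))// expr1n mul1e vE.
have [<-|ij] := eqVneq; first by rewrite mulr1 -(varX i).
rewrite -(X_corr ij) /correlation !varX /= -expr2 sqr_sqrtr ?ltW//.
rewrite mulrCA divff ?gt_eqF// mulr1 fineK//.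
have fT : P setT \is a fin_num by exact: fin_num_measure.
apply: covariance_fin_num; [exact: Lfun_subset12|exact: Lfun_subset12|].
exact: Lfun2_mul_Lfun1.
Qed.

(** Joint normality gives the combination a normal law with unknown parameters [m] and [s]. They are
    identified by computing its expectation and its variance by linearity; the factor [v]
    cancels. *)
Lemma equicorrelated_mgf (a : 'I_n -> R) :
  (\int[P]_w (expR (\sum_i a i * (X i w - mu i)))%:E =
   (expR (equicorr_form rho a / 2))%:E)%E.
Proof.
have [m [s [s0 lawL]]] := X_joint a.
set L := fun w => _ in lawL.
have mL : measurable_fun setT L.
  by apply: measurable_sum => i; exact: measurable_funM.
have mE : m = \sum_i a i * mu i.
  apply: EFin_inj; rewrite -(normal_law_expectation mL lawL) expectation_lincomb//.
  rewrite -sumEFin; apply: eq_bigr => i _.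
  by rewrite (normal_law_expectation (mX i) (X_marg i)).
have sE : s ^+ 2 = equicorr_form rho a.
  apply: (mulIf (lt0r_neq0 v_gt0)); apply: EFin_inj.
  rewrite EFinM -vE -(normal_law_variance mL lawL s0) /variance.
  have L2 := normal_law_Lfun2 mL lawL.
  rewrite {1}/L covariance_lincomb//.
  have covL i : covariance P (X i) L = (v * ((1 - rho) * a i + rho * \sum_j a j))%:E.
    rewrite covarianceC covariance_lincomb//.
    under eq_bigr => j _ do rewrite covX -EFinM.
    rewrite sumEFin; congr EFin; rewrite (bigD1 i)//= eqxx.
    rewrite [in RHS](bigD1 i)//=.
    rewrite (eq_bigr (fun j => v * rho * a j)) => [|j /negbTE ->]; last by ring.
    by rewrite -mulr_sumr; ring.
  under eq_bigr => i _ do rewrite covL -EFinM.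
  rewrite sumEFin; congr EFin; rewrite /equicorr_form.
  set A := \sum_j a j.
  rewrite (eq_bigr (fun i => v * (1 - rho) * a i ^+ 2 + v * rho * A * a i)); last first.
    by move=> i _; ring.
  by rewrite big_split/= -!mulr_sumr -/A; ring.
under eq_integral => w _.
  rewrite (_ : \sum_i _ = 1 * L w - m); last first.
    by rewrite mul1r mE /L -sumrB; apply: eq_bigr => i _; rewrite mulrBr.
  rewrite addrC expRD EFinM; over.
rewrite ge0_integralZl//; last first.
  by apply/measurable_EFinP; apply: measurableT_comp => //; exact: measurable_funM.
rewrite (normal_law_mgf mL lawL) -EFinM -expRD sE; congr (expR _)%:E; ring.
Qed.

End Equicorrelated.

(** * Step-up procedures *)

(** The event is a finite union, over the accepted truth tables [h], of finite intersections of the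
    events [b i w = h i]. *)
Lemma measurable_finite_data d (T : measurableType d) (B : finType)
    (b : B -> T -> bool) (G : {ffun B -> bool} -> bool) :
    (forall i, measurable [set w | b i w]) ->
  measurable [set w | G [ffun i => b i w]].
Proof.
move=> mb.
have -> : [set w | G [ffun i => b i w]] =
    \bigcup_(h in [set h | G h]) \bigcap_(i in [set: B]) [set w | b i w = h i].
  apply/seteqP; split=> [w Gw|w [h Gh hw]].
    by exists [ffun i => b i w] => // i _ /=; rewrite ffunE.
  by rewrite /= (_ : [ffun i => b i w] = h)//; apply/ffunP => i; rewrite ffunE hw.
apply: fin_bigcup_measurable => [|h _]; first exact: finite_finset.
apply: fin_bigcap_measurable => [|i _]; first exact: finite_finset.
case: (h i); first exact: mb.
rewrite (_ : mkset _ = ~` [set w | b i w]); last first.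
  by apply/seteqP; split=> w /=; [move=> ->|move/negP/negbTE].
exact: measurableC.
Qed.

Section StepUp.
Context {R : realType} (n : nat) (u : nat -> R).
Implicit Types p : 'I_n -> R.

Lemma size_ordered_hypotheses p : size (ordered_hypotheses p) = n.
Proof. by rewrite size_sort size_enum_ord. Qed.

Lemma nth_ordered_pvalues p (k : 'I_n) :
  (ordered_pvalues p)`_k = p (nth k (ordered_hypotheses p) k).
Proof. by rewrite (nth_map k)// size_ordered_hypotheses. Qed.

Lemma measurable_step_up d (T : measurableType d) (p : 'I_n -> T -> R)
    (Q : pred {set 'I_n}) : (forall i, measurable_fun setT (p i)) ->
  measurable [set w | Q (step_up u (fun i => p i w))].
Proof.
move=> mp.
(* The rejected set depends only on finitely many comparisons: [inl (i, j)] records [p i <= p j],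
   which determines the sorting, and [inr (i, k)] records [p i <= u k.+1], which determines the
   cutoff. [G] runs the procedure on this table. *)
pose G (h : {ffun ('I_n * 'I_n) + ('I_n * 'I_n) -> bool}) :=
  let s := sort (fun i j => h (inl (i, j))) (enum 'I_n) in
  let m := (\max_(k < n | h (inr (nth k s k, k))) k.+1)%N in
  Q [set i in take m s].
pose b (c : ('I_n * 'I_n) + ('I_n * 'I_n)) w := match c with
    | inl ij => p ij.1 w <= p ij.2 w
    | inr ik => p ik.1 w <= u ik.2.+1
    end.
have -> : [set w | Q (step_up u (fun i => p i w))] = [set w | G [ffun c => b c w]].
  apply/funext => w /=; congr (is_true (Q _)); rewrite /step_up.
  have -> : sort (fun i j => [ffun c => b c w] (inl (i, j))) (enum 'I_n) =
      ordered_hypotheses (fun i => p i w).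
    by congr sort; apply/funext => i; apply/funext => j; rewrite ffunE.
  congr [set i in take _ _]%SET; apply/funext => _; apply: eq_bigl => k.
  by rewrite ffunE /= nth_ordered_pvalues.
apply: measurable_finite_data => -[ij|ik] /=; exact: measurable_ler_set.
Qed.

(** Some ordered p-value meets its cutoff, and every earlier one is no larger. As [k] counts from 0,
    this gives at least [k + 1] p-values below the cutoff [u k.+1]. *)
Lemma step_up_rejection p (i : 'I_n) : i \in step_up u p ->
  exists k : 'I_n, (k < #|[set j | (p j <= u k.+1)%R]%SET|)%N.
Proof.
rewrite /step_up inE => im.
have [k pk] : exists k : 'I_n, (ordered_pvalues p)`_k <= u k.+1.
  (* If no cutoff were met, the maximum would be over the empty family, hence 0, and nothing would
     be rejected. *)
  apply: contrapT => /forallNP nk; move: im; rewrite big_pred0 ?take0// => k.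
  exact/negP.
exists k; set s := ordered_hypotheses p in pk *.
have uniq_s : uniq s by rewrite sort_uniq enum_uniq.
have sz : size (take k.+1 s) = k.+1 by rewrite size_takel// size_ordered_hypotheses.
set A := [set j | _]%SET; suff : (size (take k.+1 s) <= #|A|)%N by rewrite sz.
rewrite -(card_uniqP (take_uniq _ uniq_s)); apply: subset_leq_card.
apply/fintype.subsetP => j jk; rewrite inE; apply: le_trans _ pk.
rewrite nth_ordered_pvalues -/s.
have le_sorted : sorted (fun i j => p i <= p j) s.
  by apply: sort_sorted => a b; exact: le_total.
have js : j \in s by exact: mem_take jk.
rewrite -{1}(nth_index k js).
apply: (sorted_leq_nth _ _ k le_sorted).
- by move=> a b c; exact: le_trans.
- by move=> a; exact: lexx.
- by rewrite inE index_mem.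
- by rewrite inE size_ordered_hypotheses.
- by rewrite -ltnS index_ltn.
Qed.

End StepUp.

(** * Tail bounds for the common part and the residuals *)

Section Centering.
Context {R : realType} {n : nat}.
Implicit Types (x b : 'I_n -> R).

Definition mean x : R := n%:R^-1 * \sum_i x i.

(** Centering is self-adjoint, so it can be moved to the weights, where [equicorrelated_mgf]
    applies. *)
Lemma sum_centered x b : \sum_j b j * (x j - mean x) =
  \sum_i (b i - mean b) * x i.
Proof.
under eq_bigr do rewrite mulrBr; under [RHS]eq_bigr do rewrite mulrBl.
rewrite !sumrB; congr (_ - _); rewrite -mulr_suml -mulr_sumr /mean; ring.
Qed.

(** Centered weights sum to 0, which kills the [rho] term. Residuals therefore carry the factor
    [1 - rho < 1] on which the final union bound rests. *)
Lemma equicorr_form_centered rho b : (0 < n)%N ->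
  equicorr_form rho (fun i => b i - mean b) =
  (1 - rho) * (\sum_i b i ^+ 2 - n%:R^-1 * (\sum_i b i) ^+ 2).
Proof.
move=> n0; have nN0 : n%:R != 0 :> R by rewrite pnatr_eq0 -lt0n.
have sumc : \sum_(i < n) mean b = \sum_i b i.
  by rewrite sumr_const card_ord -mulr_natl /mean mulVKf.
rewrite /equicorr_form sumrB sumc subrr expr0n/= mulr0 addr0; congr (_ * _).
rewrite (eq_bigr (fun i => b i ^+ 2 + (- 2 * mean b) * b i + mean b ^+ 2)); last first.
  by move=> i _; ring.
rewrite !big_split/= sumr_const card_ord -mulr_natl -mulr_sumr /mean.
by field.
Qed.

Definition common (mu x : 'I_n -> R) : R := mean (fun i => x i - mu i).

Definition residual (mu x : 'I_n -> R) (j : 'I_n) : R := x j - mu j - common mu x.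

End Centering.

Section Bounds.
Context {R : realType} {d : measure_display} {T : measurableType d}.
Variables (P : probability T R) (n : nat) (X : 'I_n -> {RV P >-> R}).
Variables (mu : 'I_n -> R) (rho : R).
Hypotheses (rho0 : 0 < rho) (rho1 : rho < 1) (n_gt0 : (0 < n)%N).
Hypothesis X_joint : jointly_normal X.
Hypothesis X_marg : forall i, has_normal_law P (X i) (mu i) 1.
Hypothesis X_corr : forall i j, i != j -> correlation P (X i) (X j) = rho.

Local Notation U w := (common mu (fun i => X i w)).
Local Notation Y j w := (residual mu (fun i => X i w) j).

Lemma centered_mgf (b : 'I_n -> R) :
  (\int[P]_w (expR (\sum_j b j * Y j w))%:E =
   (expR ((1 - rho) / 2 * (\sum_i b i ^+ 2 - n%:R^-1 * (\sum_i b i) ^+ 2)))%:E)%E.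
Proof.
under eq_integral do rewrite sum_centered.
rewrite (equicorrelated_mgf X_joint X_marg X_corr) equicorr_form_centered//.
by congr (expR _)%:E; ring.
Qed.

Let sum_delta (s : R) (j : 'I_n) (f : 'I_n -> R) :
  \sum_i s * (i == j)%:R * f i = s * f j.
Proof.
rewrite (bigD1 j)//= eqxx mulr1 big1 ?addr0// => i /negbTE ->.
by rewrite mulr0 mul0r.
Qed.

Lemma residual_mgf (s : R) j : (\int[P]_w (expR (s * Y j w))%:E =
   (expR ((1 - rho) / 2 * s ^+ 2 * (1 - n%:R^-1)))%:E)%E.
Proof.
have := centered_mgf (fun i => s * (i == j)%:R).
under eq_integral do rewrite sum_delta; move=> ->; congr (expR _)%:E.
have -> : \sum_(i < n) s * (i == j)%:R = s.
  by rewrite -[RHS]mulr1 -(sum_delta s j (fun=> 1)); apply: eq_bigr => i _; rewrite mulr1.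
rewrite (eq_bigr (fun i => s * (i == j)%:R * s)); last first.
  by move=> i _; case: (i == j); rewrite /=; ring.
by rewrite (sum_delta s j (fun=> s)); ring.
Qed.

(** For [j != k] the exponent is [(1 - rho) * s ^+ 2 / n] below that of the product of the two
    expectations: this is the negative correlation. *)
Lemma residual_mgf2 (s : R) j k : (\int[P]_w (expR (s * Y j w) * expR (s * Y k w))%:E =
   (expR ((1 - rho) * s ^+ 2 * (1 + (j == k)%:R - 2 * n%:R^-1)))%:E)%E.
Proof.
have := centered_mgf (fun i => s * (i == j)%:R + s * (i == k)%:R).
have sumE f : \sum_i (s * (i == j)%:R + s * (i == k)%:R) * f i = s * f j + s * f k.
  by rewrite -!sum_delta -big_split/=; apply: eq_bigr => i _; rewrite mulrDl.
under eq_integral do rewrite sumE expRD; move=> ->; congr (expR _)%:E.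
have -> : \sum_i (s * (i == j)%:R + s * (i == k)%:R) = 2 * s.
  by have := sumE (fun=> 1); under eq_bigr do rewrite mulr1; move=> ->; ring.
under eq_bigr do rewrite expr2.
rewrite (sumE (fun i => s * (i == j)%:R + s * (i == k)%:R)) !eqxx [k == j]eq_sym.
have nN0 : n%:R != 0 :> R by rewrite pnatr_eq0 -lt0n.
by case: (j == k); rewrite /=; field.
Qed.

Lemma mean_mgf (s : R) : (\int[P]_w (expR (s * U w))%:E =
   (expR (((1 - rho) * n%:R^-1 + rho) * s ^+ 2 / 2))%:E)%E.
Proof.
have nN0 : n%:R != 0 :> R by rewrite pnatr_eq0 -lt0n.
have := equicorrelated_mgf X_joint X_marg X_corr (fun=> s / n%:R).
under eq_integral => w _ do rewrite -mulr_sumr -mulrA; move=> ->.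
rewrite /equicorr_form !sumr_const card_ord; congr (expR _)%:E.
by rewrite -[_ *+ n]mulr_natl -[(s / _) *+ n]mulr_natl; field.
Qed.

Lemma measurable_mean : measurable_fun setT (fun w => U w).
Proof.
apply: measurable_funM => //; apply: measurable_sum => i.
exact: measurable_funB.
Qed.

Lemma measurable_residual j : measurable_fun setT (fun w => Y j w).
Proof.
by apply: measurable_funB; [exact: measurable_funB|exact: measurable_mean].
Qed.


(** Markov's inequality for [exp U], whose expectation is at most [exp (1 / 2)] since [U] has
    variance at most 1. *)
Lemma common_tail (K : R) :
  (P [set w | (K <= U w)%R] <= (expR (1 / 2 - K))%:E)%E.
Proof.
have -> : [set w | K <= U w] = [set w | expR K <= expR (1 * U w)].
  by apply/funext => w /=; rewrite ler_expR mul1r.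
apply: (le_trans (markov_ge0 _ _ _ _)).
- exact: expR_gt0.
- by apply: measurableT_comp => //; apply: measurable_funM => //; exact: measurable_mean.
- by move=> w; exact: expR_ge0.
rewrite mean_mgf -EFinM lee_fin -expRN -expRD ler_expR expr1n mulr1 addrC lerD2r.
have n1 : n%:R^-1 <= 1 :> R by rewrite invf_le1 ?ltr0n// ler1n.
by have := rho0; have := rho1; nra.
Qed.

Let measurable_exp_residual (s : R) j : measurable_fun setT (fun w => expR (s * Y j w)).
Proof.
by apply: measurableT_comp => //; apply: measurable_funM => //; exact: measurable_residual.
Qed.

Lemma expectation_mean_exp (s : R) :
  (\int[P]_w (mean (fun j => expR (s * Y j w)))%:E =
   (expR ((1 - rho) / 2 * s ^+ 2 * (1 - n%:R^-1)))%:E)%E.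
Proof.
have nN0 : n%:R != 0 :> R by rewrite pnatr_eq0 -lt0n.
rewrite /mean; under eq_integral do rewrite EFinM -sumEFin.
rewrite ge0_integralZl//; last 2 first.
- apply: emeasurable_sum => j; apply/measurable_EFinP; exact: measurable_exp_residual.
- by move=> w _; apply: sume_ge0 => j _; rewrite lee_fin expR_ge0.
rewrite ge0_integral_sum//; last first.
  by move=> j; apply/measurable_EFinP; exact: measurable_exp_residual.
under eq_bigr do rewrite residual_mgf.
by rewrite sumEFin -EFinM sumr_const card_ord -(mulr_natl (expR _)) mulKf.
Qed.

Let measurable_mean_exp (s : R) :
  measurable_fun setT (fun w => mean (fun j => expR (s * Y j w))).
Proof.
by apply: measurable_funM => //; apply: measurable_sum => j; exact: measurable_exp_residual.
Qed.

Let mean_exp_ge0 (s : R) w : 0 <= mean (fun j => expR (s * Y j w)).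
Proof. by rewrite mulr_ge0 ?invr_ge0// sumr_ge0// => j _; exact: expR_ge0. Qed.

(** Markov's inequality. It serves twice: at [s = - 2 * t] to control a second moment, and at
    [s = r] as a union bound over the residuals. *)
Lemma mean_exp_upper_tail (s B : R) : 0 < B ->
  (P [set w | (B <= mean (fun j => expR (s * Y j w)))%R] <=
   (expR ((1 - rho) / 2 * s ^+ 2) / B)%:E)%E.
Proof.
move=> B0; apply: (le_trans (markov_ge0 _ _ _ _)) => //.
rewrite expectation_mean_exp -EFinM lee_fin [leRHS]mulrC.
apply: ler_wpM2l; first by rewrite invr_ge0 ltW.
rewrite ler_expR; apply: ler_piMr; last by rewrite gerBl invr_ge0.
by apply: mulr_ge0; [rewrite divr_ge0// subr_ge0 ltW|exact: sqr_ge0].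
Qed.

(* Chebyshev's inequality: the [exp (s Y_j)] are pairwise negatively
   correlated, so the variance of their mean is of order [1 / n]. *)
Lemma mean_exp_lower_tail (s : R) :
  (P [set w | (mean (fun j => expR (s * Y j w)) <=
               expR ((1 - rho) / 2 * s ^+ 2 * (1 - n%:R^-1)) / 2)%R] <=
   (4 * expR (s ^+ 2) / n%:R)%:E)%E.
Proof.
set m := expR _; pose S w := mean (fun j => expR (s * Y j w)).
have ES : (\int[P]_w (S w)%:E = m%:E)%E by exact: expectation_mean_exp.
have m0 : 0 < m by exact: expR_gt0.
have nN0 : n%:R != 0 :> R by rewrite pnatr_eq0 -lt0n.
have n0 : 0 < n%:R^-1 :> R by rewrite invr_gt0 ltr0n.
have n1 : n%:R^-1 <= 1 :> R by rewrite invf_le1 ?ltr0n// ler1n.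
have mS : measurable_fun setT S by exact: measurable_mean_exp.
pose e j k := expR ((1 - rho) * s ^+ 2 * (1 + (j == k :> 'I_n)%:R - 2 * n%:R^-1)).
have ES2 : (\int[P]_w (S w ^+ 2)%:E =
    (n%:R^-1 ^+ 2 * \sum_j \sum_k e j k)%:E)%E.
  under eq_integral => w _.
    rewrite /S /mean exprMn [X in _ * X]expr2 mulr_suml.
    under eq_bigr do rewrite mulr_sumr.
    rewrite EFinM -sumEFin; under eq_bigr do rewrite -sumEFin.
    over.
  have mjk j k : measurable_fun setT (fun w => (expR (s * Y j w) * expR (s * Y k w))%:E).
    by apply/measurable_EFinP; apply: measurable_funM; exact: measurable_exp_residual.
  have jk0 j k w : (0 <= (expR (s * Y j w) * expR (s * Y k w))%:E)%E.
    by rewrite lee_fin mulr_ge0 ?expR_ge0.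
  rewrite ge0_integralZl//; last 2 first.
  - by apply: emeasurable_sum => j; apply: emeasurable_sum => k; exact: mjk.
  - by move=> w _; do 2 (apply: sume_ge0 => ? _); exact: jk0.
  rewrite ge0_integral_sum//; last 2 first.
  - by move=> j; apply: emeasurable_sum => k; exact: mjk.
  - by move=> j w _; apply: sume_ge0 => k _; exact: jk0.
  under eq_bigr do rewrite ge0_integral_sum//.
  rewrite (eq_bigr (fun j => (\sum_k e j k)%:E)) => [|j _]; last first.
    by rewrite -sumEFin; apply: eq_bigr => k _; rewrite residual_mgf2.
  by rewrite sumEFin -EFinM.
have EV : (\int[P]_w ((S w - m) ^+ 2)%:E =
    (n%:R^-1 ^+ 2 * (\sum_j \sum_k e j k) - m ^+ 2)%:E)%E.
  have mV : measurable_fun setT (fun w => ((S w - m) ^+ 2)%:E).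
    by apply/measurable_EFinP; apply: measurable_funX; exact: measurable_funB.
  (* The square is expanded with [2 * m * S] moved to the left, so that all integrands are
     nonnegative and additivity needs no integrability. *)
  have : (\int[P]_w ((S w - m) ^+ 2)%:E + (2 * m ^+ 2)%:E =
      (n%:R^-1 ^+ 2 * (\sum_j \sum_k e j k))%:E + (m ^+ 2)%:E)%E.
    have -> : ((2 * m ^+ 2)%:E = \int[P]_w ((2 * m) * S w)%:E)%E.
      under eq_integral do rewrite EFinM.
      have m2 : (0 <= (2 * m)%:E)%E by rewrite lee_fin mulr_ge0// ltW.
      have S0 w : (0 <= (S w)%:E)%E by rewrite lee_fin mean_exp_ge0.
      rewrite ge0_integralZl//; last exact/measurable_EFinP.
      by rewrite ES -EFinM; congr EFin; ring.
    have -> : ((m ^+ 2)%:E = \int[P]_w (m ^+ 2)%:E)%E.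
      by rewrite integral_cst//= [X in (_ * X)%E]probability_setT mule1.
    rewrite -ES2 -!ge0_integralD//.
    - by apply: eq_integral => w _; rewrite -!EFinD; congr EFin; ring.
    - by move=> w _; rewrite lee_fin sqr_ge0.
    - by apply/measurable_EFinP; exact: measurable_funX.
    - by move=> w _; rewrite lee_fin sqr_ge0.
    - by move=> w _; rewrite lee_fin sqr_ge0.
    - by move=> w _; rewrite lee_fin mulr_ge0 ?mean_exp_ge0//; lra.
    - by apply/measurable_EFinP; exact: measurable_funM.
  case: (\int[P]_w _)%E => [r| |]//=; rewrite -!EFinD => -[h].
  by congr EFin; lra.
have bound : n%:R^-1 ^+ 2 * (\sum_j \sum_k e j k) - m ^+ 2 <= m ^+ 4 / n%:R.
  (* Off the diagonal [e j k <= m ^+ 2]; on it [e j j = m ^+ 4]. Only the [n] diagonal terms survive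
     the subtraction of [m ^+ 2]. *)
  have ejk j k : e j k <= m ^+ 2 + (k == j)%:R * m ^+ 4.
    rewrite /e eq_sym /m -!expRM_natl; case: (k == j); rewrite ?mul1r ?mul0r ?addr0.
      rewrite ler_wpDl ?expR_ge0// ler_expR le_eqVlt; apply/orP; left; apply/eqP.
      by rewrite /=; field.
    rewrite ler_expR -subr_ge0 /=.
    rewrite (_ : _ - _ = (1 - rho) * s ^+ 2 * n%:R^-1); last by field.
    apply: mulr_ge0; last exact: ltW.
    by apply: mulr_ge0; [rewrite subr_ge0 ltW|exact: sqr_ge0].
  have : \sum_j \sum_k e j k <= n%:R ^+ 2 * m ^+ 2 + n%:R * m ^+ 4.
    apply: (@le_trans _ _ (\sum_(j < n) \sum_(k < n) (m ^+ 2 + (k == j)%:R * m ^+ 4))).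
      by apply: ler_sum => j _; apply: ler_sum => k _; exact: ejk.
    under eq_bigr => j _.
      rewrite big_split/= sumr_const card_ord -mulr_natl (bigD1 j)//= eqxx mul1r.
      rewrite big1 ?addr0; last by move=> k /negbTE ->; rewrite mul0r.
      over.
    rewrite sumr_const card_ord -(mulr_natl (_ + _)).
    by rewrite mulrDr mulrA.
  move=> h; have := ler_wpM2l (sqr_ge0 n%:R^-1) h.
  move/le_trans; rewrite lerBlDr; apply.
  by rewrite le_eqVlt; apply/orP; left; apply/eqP; field.
apply: (@le_trans _ _ (P [set w | (m ^+ 2 / 4 <= (S w - m) ^+ 2)%R])).
  apply: le_measure; rewrite ?inE.
  - exact: measurable_ler_set.
  - by apply: measurable_ler_set => //; apply: measurable_funX; exact: measurable_funB.
  - by move=> w /= Sm; rewrite -/(S w) in Sm *; nra.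
apply: (le_trans (markov_ge0 _ _ _ _)).
- by rewrite divr_gt0 ?exprn_gt0.
- by apply: measurable_funX; exact: measurable_funB.
- by move=> w; exact: sqr_ge0.
rewrite EV -EFinM lee_fin.
apply: (@le_trans _ _ ((m ^+ 2 / 4)^-1 * (m ^+ 4 / n%:R))).
  by rewrite ler_wpM2l ?invr_ge0 ?divr_ge0 ?sqr_ge0.
have -> : (m ^+ 2 / 4)^-1 * (m ^+ 4 / n%:R) = 4 * m ^+ 2 / n%:R.
  by field; rewrite nN0 gt_eqF.
rewrite ler_wpM2r ?(ltW n0)// ler_wpM2l// -expRM_natl ler_expR.
rewrite [leLHS](_ : _ = (1 - rho) * (1 - n%:R^-1) * s ^+ 2); last by field.
rewrite ler_piMl ?sqr_ge0//.
by have := rho0; have := rho1; move=> h1 h2; apply: mulr_ile1; lra.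
Qed.

End Bounds.

(** * Rejections of Hochberg's procedure *)

Lemma ler_amgm_div {R : realFieldType} (x L : R) : 0 < L -> x <= L + x ^+ 2 / L.
Proof.
move=> L0; rewrite -(ler_pM2r L0) mulrDl mulfVK ?gt_eqF//; nra.
Qed.

(** A deterministic statement. If the first three alternatives fail, the indices outside [A], whose
    p-values exceed the cutoff [q], must carry much of the mean of [exp (- t * Y_j)]. The bound [B]
    on the second moment then makes them more than a fraction [1 / (4 * B)] of all indices. So
    [q < 4 * alpha * B / n], and any index in [A] has an observation above [r]. *)
Lemma hochberg_rejection {R : realType} {n : nat} (alpha M K t B r : R)
    (mu x : 'I_n -> R) (i : 'I_n) :
    0 < alpha -> alpha < 1 / 2 -> (forall j, mu j <= M) ->
    0 <= t -> 0 <= K + M + 2 -> 0 < B -> 0 <= r ->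
    4 * alpha * B / n%:R < normal_pdf 0 1 (r + 1) ->
    i \in hochberg alpha (fun j => pvalue (x j)) ->
  [\/ K <= common mu x,
      mean (fun j => expR (- t * residual mu x j)) <= 2 * expR (t * (K + M + 2)),
      B <= mean (fun j => expR (- 2 * t * residual mu x j)) |
      exists j, r - M - K <= residual mu x j].
Proof.
move=> alpha0 alpha_lt muM t0 c0 B0 r0 hr /step_up_rejection[k Hk].
case: (leP K (common mu x)) => [|U_K]; first by constructor 1.
case: (leP (mean _) (2 * _)) => [|S_big]; first by constructor 2.
case: (leP B (mean _)) => [|Q_small]; first by constructor 3.
constructor 4; apply: contrapT => /forallNP Y_small.
have n0 : (0 < n)%N by exact: leq_ltn_trans (ltn_ord k).
have nR0 : 0 < n%:R :> R by rewrite ltr0n.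
set q := alpha / _ in Hk; set A := [set j | _]%SET in Hk.
(* The denominator of the cutoff at [k.+1]. It equals [n - k], and [A] has more than [k] elements,
   so fewer than [kappa] indices lie outside [A]. *)
pose kappa := (n - k.+1 + 1)%N.
have kappa0 : (0 < kappa)%N by rewrite /kappa addn1.
have kR0 : 0 < kappa%:R :> R by rewrite ltr0n.
have q_alpha : q <= alpha by rewrite ler_pdivrMr// ler_peMr ?ler1n// ltW.
have card_CA : (#|~: A| < kappa)%N.
  have cA := cardsC A; rewrite card_ord in cA.
  by rewrite /kappa addn1 ltnS leq_subRL// -[X in (_ <= X)%N]cA leq_add2r.
have inA j : j \in A -> - t * residual mu x j <= t * (K + M + 2).
  rewrite inE => pj; have xj : - 2 < x j.
    rewrite ltNge; apply/negP => xj; have := pvalue_nonincreasing xj.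
    by have := @pvalueN2_gt R; lra.
  rewrite mulNr -mulrN ler_wpM2l//; have := muM j; rewrite /residual; lra.
set E := expR (t * (K + M + 2)) in S_big.
have E1 : 1 <= E by rewrite -expR0 ler_expR mulr_ge0.
(* The last two terms bound [z = expR (- t * Y_j)] by [2 B + z ^+ 2 / (2 B)] for
   the indices outside [A], where [Y_j] may be very negative. *)
have term j : expR (- t * residual mu x j) <=
    E + (2 * B) * (j \notin A)%:R + expR (- 2 * t * residual mu x j) / (2 * B).
  have e0 := expR_gt0 (- t * residual mu x j).
  have e2 : expR (- 2 * t * residual mu x j) = expR (- t * residual mu x j) ^+ 2.
    by rewrite -expRM_natl; congr expR; ring.
  have [jA|jA] := boolP (j \in A); rewrite /= ?mulr0 ?mulr1 ?addr0.
    apply: (@le_trans _ _ E); first by rewrite ler_expR inA.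
    by rewrite lerDl divr_ge0 ?expR_ge0//; lra.
  rewrite e2 -addrA; apply: (le_trans (@ler_amgm_div _ _ (2 * B) _)); first by lra.
  by rewrite lerDr; lra.
have : mean (fun j => expR (- t * residual mu x j)) <=
    E + 2 * B * (#|~: A|%:R / n%:R) +
    mean (fun j => expR (- 2 * t * residual mu x j)) / (2 * B).
  rewrite /mean; set S := \sum_j expR (- t * _); set Q := \sum_j expR _.
  have : S <= n%:R * E + 2 * B * #|~: A|%:R + Q / (2 * B).
    apply: (le_trans (ler_sum _ (fun j _ => term j))).
    rewrite !big_split/= sumr_const card_ord -(mulr_natl E) -mulr_suml -mulr_sumr.
    rewrite (_ : \sum_i (i \notin A)%:R = #|~: A|%:R)// -natr_sum; congr _%:R.
    rewrite -sum1_card [RHS]big_mkcond/=; apply: eq_bigr => j _.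
    by rewrite finset.in_setC; case: (j \in A).
  have ninv : 0 <= n%:R^-1 :> R by rewrite invr_ge0.
  move/(ler_wpM2l ninv)/le_trans; apply.
  by rewrite le_eqVlt; apply/orP; left; apply/eqP; field; rewrite ?gt_eqF.
move: S_big Q_small; set S := mean _; set Q := mean _ => S_big Q_small SQ.
(* From [2 * E < S] and [1 <= E], the middle term of [SQ] exceeds [E - 1 / 2 >= 1 / 2]. *)
have QB : Q / (2 * B) < 1 / 2 by rewrite ltr_pdivrMr; lra.
have card_big : 1 / (4 * B) < #|~: A|%:R / n%:R.
  by rewrite ltr_pdivrMr; lra.
have nk : n%:R < 4 * B * kappa%:R.
  have : n%:R < 4 * B * #|~: A|%:R.
    by move: card_big; rewrite ltr_pdivlMr// mul1r mulrC ltr_pdivrMr; lra.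
  move/lt_trans; apply; rewrite ltr_pM2l ?ltr_nat//; lra.
have q_lt : q < normal_pdf 0 1 (r + 1).
  apply: lt_trans hr; rewrite /q -/kappa ltr_pdivrMr// mulrAC ltr_pdivlMr//.
  rewrite (_ : 4 * alpha * B * kappa%:R = alpha * (4 * B * kappa%:R)); last by ring.
  by rewrite ltr_pM2l.
have [j jA] : exists j, j \in A.
  by apply/card_gt0P; apply: leq_ltn_trans Hk.
have xj : r < x j.
  rewrite ltNge; apply/negP => xj; have := pvalue_nonincreasing xj.
  move: jA; rewrite inE => pj; have := std_normal_tail r0; lra.
apply: (Y_small j); have := muM j; rewrite /residual; lra.
Qed.

Lemma measurable_type1_errors {R : realType} d (T : measurableType d) n
    (mu : 'I_n -> R) (u : nat -> R) (X : 'I_n -> T -> R) :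
    (forall i, measurable_fun setT (X i)) ->
  measurable [set w | (1 <= type1_errors mu (step_up u (n := n)) (fun i => X i w))%N].
Proof.
move=> mX.
pose Q (A : {set 'I_n}) := (1 <= #|[set i | (i \in A) && (mu i == 0%R)]%SET|)%N.
apply: (@measurable_step_up R n u _ _ (fun i w => pvalue (X i w)) Q) => i.
apply: measurableT_comp => //.
by apply: nonincreasing_measurable => //; exact: pvalue_nonincreasing.
Qed.

(** * A bound on the error rate at fixed [n] *)

Section FWERBound.
Context {R : realType} {d : measure_display} {T : measurableType d}.
Variables (P : probability T R) (n : nat) (X : 'I_n -> {RV P >-> R}).
Variables (mu : 'I_n -> R) (rho alpha M K t B r : R).
Hypotheses (rho0 : 0 < rho) (rho1 : rho < 1) (n_gt0 : (0 < n)%N).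
Hypothesis X_joint : jointly_normal X.
Hypothesis X_marg : forall i, has_normal_law P (X i) (mu i) 1.
Hypothesis X_corr : forall i j, i != j -> correlation P (X i) (X j) = rho.

(** The four summands bound, in order, the probabilities of the four alternatives of
    [hochberg_rejection]. The last hypothesis puts the second alternative inside the event of
    [mean_exp_lower_tail]. *)
Lemma FWER_hochberg_le :
    0 < alpha -> alpha < 1 / 2 -> (forall j, mu j <= M) ->
    0 <= t -> 0 <= K + M + 2 -> 0 < B -> 0 <= r ->
    4 * alpha * B / n%:R < normal_pdf 0 1 (r + 1) ->
    4 * expR (t * (K + M + 2)) <= expR ((1 - rho) / 2 * t ^+ 2 * (1 - n%:R^-1)) ->
  (FWER mu (hochberg alpha (n := n)) X <=
   (expR (1 / 2 - K) + 4 * expR (t ^+ 2) / n%:R +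
    expR (2 * (1 - rho) * t ^+ 2) / B +
    n%:R * expR ((1 - rho) / 2 * r ^+ 2 - r * (r - M - K)))%:E)%E.
Proof.
move=> alpha0 alpha_lt muM t0 c0 B0 r0 hr ht.
pose Y j w := residual mu (fun i => X i w) j.
pose E1 := [set w | K <= common mu (fun i => X i w)].
pose E2 := [set w | mean (fun j => expR (- t * Y j w)) <=
  expR ((1 - rho) / 2 * (- t) ^+ 2 * (1 - n%:R^-1)) / 2].
pose E3 := [set w | B <= mean (fun j => expR (- 2 * t * Y j w))].
(* One residual above [r - M - K] puts the mean of the exponentials above this threshold, as each
   exponential is at most [n] times their mean. *)
pose E4 := [set w | expR (r * (r - M - K)) / n%:R <= mean (fun j => expR (r * Y j w))].
have nR0 : 0 < n%:R :> R by rewrite ltr0n.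
have mexp s : measurable_fun setT (fun w => mean (fun j => expR (s * Y j w))).
  apply: measurable_funM => //; apply: measurable_sum => j.
  apply: measurableT_comp => //; apply: measurable_funM => //.
  exact: measurable_residual.
have mE1 : measurable E1 by apply: measurable_ler_set => //; exact: measurable_mean.
have mE2 : measurable E2 by exact: measurable_ler_set.
have mE3 : measurable E3 by exact: measurable_ler_set.
have mE4 : measurable E4 by exact: measurable_ler_set.
have sub : [set w | (1 <= type1_errors mu (hochberg alpha (n := n)) (fun i => X i w))%N]
    `<=` E1 `|` E2 `|` E3 `|` E4.
  move=> w /= /card_gt0P[i]; rewrite inE => /andP[iT _].
  have [] := hochberg_rejection alpha0 alpha_lt muM t0 c0 B0 r0 hr iT.
  - by move=> h; do 3 left.
  - move=> h; left; left; right; rewrite /E2 /= sqrrN; apply: (le_trans h).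
    by rewrite ler_pdivlMr//; lra.
  - by move=> h; left; right.
  - move=> [j h]; right; rewrite /E4/= mulrC; apply: ler_wpM2l; first by rewrite invr_ge0 ltW.
    rewrite (bigD1 j)//=; apply: (@le_trans _ _ (expR (r * Y j w))).
      by rewrite ler_expR ler_wpM2l.
    by rewrite lerDl sumr_ge0// => k _; exact: expR_ge0.
rewrite /FWER; apply: (@le_trans _ _ (P (E1 `|` E2 `|` E3 `|` E4))).
  apply: le_measure => //; rewrite inE; last by do !apply: measurableU.
  by apply: measurable_type1_errors => i; exact: measurable_funPT.
have mE12 := measurableU _ _ mE1 mE2; have mE123 := measurableU _ _ mE12 mE3.
apply: (le_trans (measureU2 P mE123 mE4)); rewrite EFinD; apply: leeD.
  apply: (le_trans (measureU2 P mE12 mE3)); rewrite EFinD; apply: leeD.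
    apply: (le_trans (measureU2 P mE1 mE2)); rewrite EFinD; apply: leeD.
- exact: (common_tail rho0 rho1 n_gt0 X_joint X_marg X_corr).
- have := mean_exp_lower_tail rho0 rho1 n_gt0 X_joint X_marg X_corr (- t).
  by rewrite /E2 sqrrN.
- have := mean_exp_upper_tail rho1 n_gt0 X_joint X_marg X_corr (- 2 * t) B0.
  by congr (_ <= (expR _ / _)%:E)%E; field.
- have e0 : 0 < expR (r * (r - M - K)) / n%:R by rewrite divr_gt0 ?expR_gt0.
  have := mean_exp_upper_tail rho1 n_gt0 X_joint X_marg X_corr r e0.
  by congr (_ <= _%:E)%E; rewrite invf_div expRD expRN; field; rewrite gt_eqF ?expR_gt0.
Qed.

End FWERBound.

(** * Choice of the parameters and passage to the limit *)

Lemma cvg0_eventually_le {R : realType} (u : nat -> \bar R) :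
    (forall n, 0 <= u n)%E ->
    (forall e : R, 0 < e -> \forall n \near \oo, (u n <= e%:E)%E) ->
  u n @[n --> \oo] --> 0%E.
Proof.
move=> u0 ue; apply/fine_cvgP; split.
  near=> n; rewrite ge0_fin_numE//; apply: le_lt_trans (ltry 1).
  by near: n; exact: ue.
apply/cvgr0Pnorm_le => e e0; near=> n.
have uen : (u n <= e%:E)%E by near: n; exact: ue.
have ufin : u n \is a fin_num by rewrite ge0_fin_numE// (le_lt_trans uen (ltry _)).
by rewrite ger0_norm ?fine_ge0// -lee_fin fineK.
Unshelve. all: by end_near. Qed.

Theorem theorem4p2 (R : realType) (rho alpha : R) (mu : nat -> R)
    (d : nat -> measure_display) (W : forall n, measurableType (d n))
    (P : forall n, probability (W n) R)
    (X : forall n, 'I_n -> {RV (P n) >-> R})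
    (rho_gt0 : 0 < rho) (rho_lt1 : rho < 1)
    (alpha_gt0 : 0 < alpha) (alpha_lt : alpha < 1 / 2)
    (mu_ge0 : forall i, 0 <= mu i)
    (mu_sup : (ereal_sup (range (fun i => (mu i)%:E)) < +oo)%E)
    (X_joint : forall n, jointly_normal (X n))
    (X_marg : forall n (i : 'I_n), has_normal_law (P n) (X n i) (mu i) 1)
    (X_corr : forall n (i j : 'I_n), i != j ->
      correlation (P n) (X n i) (X n j) = rho) :
  FWER (fun i : 'I_n => mu i) (hochberg alpha (n := n)) (X n) @[n --> \oo]
    --> 0%E.
Proof.
apply: cvg0_eventually_le => [n|e e0]; first exact: measure_ge0.
have [M muM] : exists M, forall i, mu i <= M.
  have le_sup i : ((mu i)%:E <= ereal_sup (range (fun i => (mu i)%:E)))%E.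
    by apply: ereal_sup_ubound; exists i.
  exists (fine (ereal_sup (range (fun i => (mu i)%:E)))) => i.
  rewrite -lee_fin fineK// ge0_fin_numE//.
  by apply: le_trans (le_sup 0%N); rewrite lee_fin.
have M0 : 0 <= M by exact: le_trans (mu_ge0 0%N) (muM 0%N).
(* Each of the four summands is to be at most [e / 4]. [K], [t], [B] and [D] do not depend on [n].
   For [K], [exp (K - 1 / 2) >= K = 4 / e]. *)
pose K := 4 / e; pose c := K + M + 2.
have K0 : 0 < K by rewrite divr_gt0.
have c0 : 0 < c by rewrite /c; lra.
(* For [n >= 2] the exponent [(1 - rho) / 2 * t ^+ 2 * (1 - 1 / n)] is then at least
   [(c + 3) * t >= t * c + 3], and [exp 3 >= 4]. *)
pose t := 4 * (c + 3) / (1 - rho).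
have t4 : 4 * (c + 3) <= t.
  by rewrite ler_pdivlMr ?subr_gt0//; apply: ler_piMr; lra.
have t_gt0 : 0 < t by lra.
pose B := expR (2 * (1 - rho) * t ^+ 2) * (4 / e).
have B0 : 0 < B by rewrite mulr_gt0 ?expR_gt0.
have peak0 : 0 < normal_peak 1 :> R by rewrite normal_peak_gt0 ?oner_neq0.
(* When [n = D * exp ((r + 1) ^ 2 / 2)], this makes [4 * alpha * B / n] exactly half of
   [normal_pdf 0 1 (r + 1)]. *)
pose D := 8 * alpha * B / normal_peak 1.
have D0 : 0 < D by rewrite divr_gt0// mulr_gt0// mulr_gt0.
pose C := M + K.
(* For [r] above the first entry, [rho * r ^+ 2 / 2] dominates the linear terms and the last summand
   is at most [D * exp (1 / 2 - r)]; above the second, this is at most [e / 4]. *)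
pose r0 := Num.max (2 * (C + 2) / rho) (4 * D / e).
have r0_gt0 : 0 < r0.
  by rewrite lt_max; apply/orP; right; rewrite divr_gt0// mulr_gt0.
near=> n.
have n2 : 2 <= n%:R :> R by near: n; exact: nbhs_infty_ger.
have nt : 4 * expR (t ^+ 2) * (4 / e) <= n%:R by near: n; exact: nbhs_infty_ger.
(* This makes the solution [r] of [n = D * exp ((r + 1) ^ 2 / 2)] at least [r0]. *)
have nD : D * expR ((r0 + 1) ^+ 2 / 2) <= n%:R by near: n; exact: nbhs_infty_ger.
have nR0 : 0 < n%:R :> R by lra.
have n_gt0 : (0 < n)%N by rewrite -(ltr0n R).
(* [r] solves [n = D * exp ((r + 1) ^ 2 / 2)], so that the union bound
   [n * exp ((1 - rho) r ^ 2 / 2 - r (r - C))] is [exp (- rho r ^ 2 / 2 + O(r))]. *)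
pose tau := Num.sqrt (2 * ln (n%:R / D)); pose r := tau - 1.
have ln_ge : (r0 + 1) ^+ 2 / 2 <= ln (n%:R / D).
  have h : expR ((r0 + 1) ^+ 2 / 2) <= n%:R / D by rewrite ler_pdivlMr// mulrC.
  have x0 : 0 < n%:R / D by rewrite divr_gt0.
  by rewrite -[leLHS]expRK ler_ln// posrE expR_gt0.
have tau2 : tau ^+ 2 = 2 * ln (n%:R / D).
  by rewrite sqr_sqrtr// mulr_ge0// (le_trans _ ln_ge)// divr_ge0// sqr_ge0.
have nE : n%:R = D * expR ((r + 1) ^+ 2 / 2).
  rewrite /r subrK tau2 (_ : _ / 2 = ln (n%:R / D)); last by field.
  have x0 : n%:R / D \is Num.pos by rewrite posrE divr_gt0.
  by rewrite lnK// [D * _]mulrC divfK// gt_eqF.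
have r_ge : r0 <= r.
  rewrite /r lerBrDr -(@ler_sqr _ (r0 + 1)) ?nnegrE ?sqrtr_ge0 ?tau2//; lra.
have r_gt0 : 0 < r by lra.
have hr : 4 * alpha * B / n%:R < normal_pdf 0 1 (r + 1).
  rewrite normal_pdfE ?oner_neq0// /normal_fun subr0 expr1n mulNr expRN nE /D.
  set E := expR ((r + 1) ^+ 2 / 2); have E0 : 0 < E by exact: expR_gt0.
  rewrite (_ : _ / _ = normal_peak 1 / E / 2); last first.
    by field; rewrite !gt_eqF.
  by have : 0 < normal_peak 1 / E by [rewrite divr_gt0]; lra.
have ht : 4 * expR (t * (K + M + 2)) <= expR ((1 - rho) / 2 * t ^+ 2 * (1 - n%:R^-1)).
  have ninv : n%:R^-1 <= 1 / 2 :> R by rewrite div1r lef_pV2 ?posrE.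
  apply: (@le_trans _ _ (expR 3 * expR (t * c))).
    by rewrite ler_wpM2r ?expR_ge0//; apply: le_trans (expR_ge1Dx _); lra.
  rewrite -expRD ler_expR.
  have tE : t * (1 - rho) = 4 * (c + 3) by rewrite divfK// subr_eq0 gt_eqF.
  rewrite (_ : _ * (1 - n%:R^-1) =
    t * (1 - rho) * (t * (1 - n%:R^-1)) / 2); last by field; rewrite gt_eqF.
  rewrite tE.
  have : t / 2 <= t * (1 - n%:R^-1) by apply: ler_wpM2l; lra.
  nra.
apply: le_trans (FWER_hochberg_le rho_gt0 rho_lt1 n_gt0 (@X_joint n)
  (@X_marg n) (@X_corr n) alpha_gt0 alpha_lt (fun j => muM j)
  (ltW t_gt0) (ltW c0) B0 (ltW r_gt0) hr ht) _.
rewrite lee_fin.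
have b1 : expR (1 / 2 - K) <= e / 4.
  rewrite -[e / 4]invf_div -/K -opprB expRN lef_pV2 ?posrE ?expR_gt0//.
  by apply: le_trans (expR_ge1Dx _); lra.
have b2 : 4 * expR (t ^+ 2) / n%:R <= e / 4.
  by rewrite ler_pdivrMr// [leRHS]mulrC -ler_pdivrMr ?divr_gt0// invf_div.
have b3 : expR (2 * (1 - rho) * t ^+ 2) / B = e / 4.
  by rewrite /B; field; rewrite !gt_eqF ?expR_gt0.
have b4 : n%:R * expR ((1 - rho) / 2 * r ^+ 2 - r * (r - M - K)) <= e / 4.
  rewrite nE -mulrA -expRD.
  have Cr : (r + 1) ^+ 2 / 2 + ((1 - rho) / 2 * r ^+ 2 - r * (r - M - K)) <= 1 / 2 - r.
    have : 2 * (C + 2) / rho <= r by apply: le_trans r_ge; rewrite le_max lexx.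
    rewrite ler_pdivrMr// => h; have : 0 <= r * (r * rho - 2 * (C + 2)).
      by apply: mulr_ge0; [exact: ltW|rewrite subr_ge0].
    rewrite /C => h2; nra.
  apply: (@le_trans _ _ (D * expR (1 / 2 - r))).
    by rewrite ler_wpM2l ?(ltW D0)// ler_expR.
  have : 4 * D / e <= expR (r - 1 / 2).
    have : 4 * D / e <= r by apply: le_trans r_ge; rewrite le_max lexx orbT.
    by move=> h; apply: le_trans (expR_ge1Dx _); lra.
  rewrite (_ : expR (1 / 2 - r) = (expR (r - 1 / 2))^-1); last first.
    by rewrite -expRN; congr expR; ring.
  by rewrite ler_pdivrMr// => h; rewrite ler_pdivrMr ?expR_gt0//; lra.
lra.
Unshelve. all: by end_near. Qed.
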